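(* Let $(X,d_X)$ and $(Y,d_Y)$ be complete, doubling, quasiconvex metric spaces. Let $f\in\mathcal F(\Omega,D)$ be a homeomorphism between a bounded domain $\Omega\subsetneq X$ satisfying the bounded turning condition and a bounded domain $D\subsetneq Y$ finitely connected at the boundary. Then $f$ has arcwise limits along all end-cuts of $\Omega$.
   Context: Conventions. A domain is a nonempty open connected set. A curve is a continuous map from a compact interval (or its image). A metric space is quasiconvex if there is $C\ge 1$ such that any two points $x,y$ are joined by a curve of length at most $C\,d(x,y)$. Inner diameter distance in a domain $\Omega$: $d_{\rm inn}(x,y)=\inf \operatorname{diam}\gamma$, the infimum over all locally rectifiable curves $\gamma\subset\Omega$ joining $x,y\in\Omega$; for $A,B\subset\Omega$, $\mathrm{dist}_{\rm inn}(A,B)=\inf_{a\in A,b\in B}d_{\rm inn}(a,b)$. Class $\mathcal F$. A homeomorphism $f$ from $\Omega$ onto $D$ belongs to $\mathcal F(\Omega,D)$ if for any two connected sets $E,F\subsetneq\Omega$: $\mathrm{dist}_{\rm inn}(E,F)=0$ if and only if $\mathrm{dist}_{\rm inn}(f(E),f(F))=0$ (the latter distance taken in $D$). Bounded turning. $\Omega$ satisfies the bounded turning condition (is linearly connected) if there is $L\ge1$ such that all $x,y\in\Omega$ lie in a continuum $K\subset\Omega$ with $\operatorname{diam}K\le L\,d_X(x,y)$. Finite connectedness. $D\subset Y$ is finitely connected at the boundary if for every $y\in\partial D$ and $r>0$ there is a bounded open set $U$ with $y\in U\subset B(y,r)$ such that $U\cap D$ has only finitely many components. End-cuts. An end-cut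 of $\Omega$ from $x\in\partial\Omega$ is a (possibly nonrectifiable) curve $\gamma:[0,1]\to X$ with $\gamma(1)=x$ and $\gamma([0,1))\subset\Omega$. Arcwise limits. A sequence $\{x_n\}$ in $\Omega$ converges along an end-cut $\gamma$ at $x$ if there are $0<t_n<1$ with $t_n\to1$ and $x_n=\gamma(t_n)$, so that $d_X(x_n,x)\to0$. The cluster set $C_\gamma(f,x)$ of $f$ at $x$ along an end-cut $\gamma$ from $x$ is the set of $x'\in Y$ for which there is a sequence $\{x_n\}$ converging along $\gamma$ at $x$ with $d_Y(f(x_n),x')\to0$. If $C_\gamma(f,x)=\{y\}$, then $y$ is called the arcwise limit (asymptotic value) of $f$ at $x$ along $\gamma$. ''$f$ has arcwise limits along all end-cuts'' means that for every $x\in\partial\Omega$ and every end-cut $\gamma$ of $\Omega$ from $x$, $C_\gamma(f,x)$ consists of exactly one point. *)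

(* Defs.v *)
From HB Require Import structures.
From mathcomp Require Import all_boot all_order all_algebra.
From mathcomp Require Import all_classical all_reals all_analysis.

Set Implicit Arguments.
Unset Strict Implicit.
Unset Printing Implicit Defensive.

Import Order.TTheory GRing.Theory Num.Theory.
Import numFieldNormedType.Exports.

Local Open Scope classical_set_scope.
Local Open Scope ring_scope.

(* The library's completeType is pointed and has no join with metricType; this
   is its axiom cauchy_cvg, without the base point. *)
Definition complete_space (T : uniformType) : Prop :=
  forall F : set_system T, ProperFilter F -> cauchy F -> exists x : T, F --> x.

Definition boundary (T : topologicalType) (A : set T) : set T :=
  closure A `\` interior A.

Definition domain (T : topologicalType) (A : set T) : Prop :=
  [/\ A !=set0, open A & connected A].

Definition continuum (T : topologicalType) (K : set T) : Prop :=
  [/\ K !=set0, compact K & connected K].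

Section metric_notions.
Context {R : realType} {X : metricType R}.
Implicit Types (A B Omega : set X) (a b : R) (g : R -> X) (x y : X).

(* For A = set0 this is -oo; it is only compared with an upper bound or used for
   nonempty A. *)
Definition diam A : \bar R :=
  ereal_sup [set (mdist p.1 p.2)%:E | p in A `*` A].

Definition bounded_subset A : Prop := (diam A < +oo)%E.

(* A curve is a function R -> X of which only the restriction to `[a, b] is
   relevant. *)
Definition curve a b g : Prop :=
  a <= b /\ {within `[a, b], continuous g}.

(* Metric-space version of variation, from numfun, with the same encoding of
   partitions: a :: s lists the points a = t_0 < ... < t_n = b. *)
Definition metric_variation a b g (s : seq R) : R :=
  let F := g \o nth b (a :: s) in
  \sum_(0 <= n < size s) mdist (F n) (F n.+1).

Definition curve_length a b g : \bar R :=
  ereal_sup [set (metric_variation a b g s)%:E | s in itv_partition a b].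

Definition locally_rectifiable a b g : Prop :=
  forall c d, a <= c -> c <= d -> d <= b -> (curve_length c d g < +oo)%E.

(* +oo if no admissible curve joins x to y in Omega. *)
Definition inner_dist Omega x y : \bar R :=
  ereal_inf [set v : \bar R | exists a b g,
    [/\ curve a b g, locally_rectifiable a b g, g @` `[a, b] `<=` Omega,
        g a = x /\ g b = y & v = diam (g @` `[a, b])]].

Definition inner_set_dist Omega A B : \bar R :=
  ereal_inf [set inner_dist Omega p.1 p.2 | p in A `*` B].

Definition bounded_turning Omega : Prop :=
  exists2 L : R, 1 <= L & forall x y, Omega x -> Omega y ->
    exists K : set X, [/\ continuum K, K `<=` Omega, K x, K y
                       & (diam K <= (L * mdist x y)%:E)%E].

Definition finitely_connected_at_boundary Omega : Prop :=
  forall y (r : R), boundary Omega y -> 0 < r ->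
    exists U : set X, [/\ open U, bounded_subset U, U y, U `<=` ball y r
      & finite_set
          [set connected_component (U `&` Omega) z | z in U `&` Omega]].

Definition end_cut Omega x g : Prop :=
  [/\ curve 0 1 g, g 1 = x & g @` `[0, 1[ `<=` Omega].

Definition converges_along g x (u : nat -> X) : Prop :=
  exists t : nat -> R,
    [/\ forall n, 0 < t n < 1, t @ \oo --> (1 : R), u = g \o t
      & u @ \oo --> x].

End metric_notions.

Definition quasiconvex (R : realType) (X : metricType R) : Prop :=
  exists2 C : R, 1 <= C & forall x y : X, exists a b g,
    [/\ curve a b g, g a = x, g b = y
      & (curve_length a b g <= (C * mdist x y)%:E)%E].

Definition doubling (R : realType) (X : metricType R) : Prop :=
  exists N : nat, forall (x : X) (r : R), 0 < r ->
    exists2 s : seq X, (size s <= N)%N &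
      ball x r `<=` \bigcup_(y in [set` s]) ball y (r / 2).

(* Maps between subsets are represented by functions on the whole spaces, whose
   values outside the subset are irrelevant. *)
Definition homeomorphism (X Y : topologicalType) (A : set X) (B : set Y)
    (f : X -> Y) : Prop :=
  [/\ set_bij A B f, {within A, continuous f}
    & exists2 h : Y -> X, {in A, cancel f h} & {within B, continuous h}].

Definition classF (R : realType) (X Y : metricType R) (Omega : set X)
    (D : set Y) (f : X -> Y) : Prop :=
  homeomorphism Omega D f /\
  forall E F : set X, connected E -> connected F ->
    E `<` Omega -> F `<` Omega ->
    (inner_set_dist Omega E F = 0%E <-> inner_set_dist D (f @` E) (f @` F) = 0%E).

Definition cluster_set (R : realType) (X Y : metricType R) (g : R -> X)
    (f : X -> Y) (x : X) : set Y :=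
  [set x' | exists2 u : nat -> X, converges_along g x u & f \o u @ \oo --> x'].

Definition arcwise_limit (R : realType) (X Y : metricType R) (g : R -> X)
    (f : X -> Y) (x : X) (y : Y) : Prop :=
  cluster_set g f x = [set y].

Definition arcwise_limits_along_all_end_cuts (R : realType)
    (X Y : metricType R) (Omega : set X) (f : X -> Y) : Prop :=
  forall (x : X) (g : R -> X), boundary Omega x -> end_cut Omega x g ->
    exists y : Y, arcwise_limit g f x y.

(* Main.v *)
Require Import Defs.
From mathcomp Require Import all_boot all_order all_algebra.
From mathcomp Require Import all_classical all_reals all_analysis.
From mathcomp Require Import finmap lra.

(** The cluster set along an end-cut is nonempty because D is totally bounded in
    a complete space. Suppose it contained y1 <> y2, boundary points of D.
    By finite connectedness, small neighbourhoods of y1 and y2 contain components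
    V1, V2 of their traces on D that f o g visits at times tending to 1, and
    dist(V1, V2) > 0. The connected sets f^-1(V1) and f^-1(V2) both accumulate
    at x, so bounded turning joins them by arbitrarily small continua; since X
    is quasiconvex, these can be replaced by rectifiable curves in small open
    subsets of Omega. Thus the inner distance of f^-1(V1) and f^-1(V2) is 0 while
    that of V1 and V2 is not, contradicting f in F(Omega, D).
    Ultrafilters take the place of subsequences throughout. *)

Set Implicit Arguments.
Unset Strict Implicit.
Unset Printing Implicit Defensive.

Import Order.TTheory GRing.Theory Num.Theory.
Import numFieldNormedType.Exports.

Local Open Scope classical_set_scope.
Local Open Scope ring_scope.

(** Pigeonhole in place of passing to a subsequence: otherwise [F] would contain every complement,
    hence their finite intersection, which misses the union. *)
Lemma ultrafilter_finite_bigcup (T : Type) (I : choiceType) (F : set_system T)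
    (S : set I) (A : I -> set T) :
  UltraFilter F -> finite_set S -> F (\bigcup_(i in S) A i) ->
  exists2 i, S i & F (A i).
Proof.
move=> FU /finite_fsetP[D ->] FA; apply: contrapT => nA.
have FC : F (\bigcap_(i in [set` D]) ~` A i).
  apply: filter_bigI => i iD.
  by case: (in_ultra_setVsetC (A i) FU) => // FAi; case: nA; exists i.
have [t [[i /= iD Ait] nAt]] := filter_ex (filterI FA FC).
exact: (nAt i iD).
Qed.

(** * Metric neighbourhoods, diameter and length of curves *)

Section metric_space.
Context {R : realType} {X : metricType R}.
Implicit Types (A G K Omega : set X) (a b c d s t : R) (g : R -> X).
Implicit Types (v : R -> R) (x y z : X) (p : seq R).

Lemma nbhs_mdistP x A :
  nbhs x A <-> exists2 e : R, 0 < e & forall y, mdist x y < e -> A y.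
Proof.
rewrite -nbhs_ballE; split=> -[e e0 eA]; exists e => // y;
  by move: (eA y); rewrite ballEmdist.
Qed.

Lemma open_mball x (r : R) : open (ball x r).
Proof.
rewrite openE => y; rewrite ballEmdist /interior/= => xy.
apply/nbhs_mdistP; exists (r - mdist x y); first by rewrite subr_gt0.
by move=> z yz /=; have := metric_triangle x y z; lra.
Qed.

Lemma within_continuousP (A : set R) g : {within A, continuous g} <->
  forall t, A t -> forall e, 0 < e -> exists2 d, 0 < d &
    forall s, A s -> `|t - s| < d -> mdist (g t) (g s) < e.
Proof.
rewrite subspace_continuousP; split=> cg t At.
  move=> e e0.
  have /(cg t At) : nbhs (g t) [set y | mdist (g t) y < e].
    by apply/nbhs_mdistP; exists e.
  rewrite /= /nbhs/= => /nbhs_ballP[d d0 dg].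
  by exists d => // s As ts; exact: dg.
move=> P /nbhs_mdistP[e e0 eP].
have [d d0 dg] := cg t At e e0.
apply/nbhs_ballP; exists d => // s ts As /=.
by apply: eP; exact: dg.
Qed.

Lemma mdist_le_diam A x y : A x -> A y -> ((mdist x y)%:E <= diam A)%E.
Proof. by move=> Ax Ay; apply: ereal_sup_ubound; exists (x, y). Qed.

Lemma diam_le A (M : R) :
  (forall x y, A x -> A y -> mdist x y <= M) -> (diam A <= M%:E)%E.
Proof.
move=> AM; apply: ge_ereal_sup => _ [[x y] /= [Ax Ay] <-].
by rewrite lee_fin AM.
Qed.

Lemma metric_variation_nil a b g : metric_variation a b g [::] = 0.
Proof. by rewrite /metric_variation big_nil. Qed.

Lemma metric_variation_cons a b c g p :
  metric_variation a b g (c :: p) = mdist (g a) (g c) + metric_variation c b g p.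
Proof. by rewrite /metric_variation /= big_nat_recl. Qed.

Lemma metric_variation_rcons a b c g p : itv_partition a b p ->
  metric_variation a c g (rcons p c) =
    metric_variation a b g p + mdist (g b) (g c).
Proof.
elim: p a => [|d p IH] a ap /=.
  by rewrite metric_variation_cons !metric_variation_nil (itv_partition_nil ap) addrC.
by rewrite !metric_variation_cons (IH d (itv_partition_cons ap)) addrA.
Qed.

Lemma itv_partition_rcons a b c p : b < c -> itv_partition a b p ->
  itv_partition a c (rcons p c).
Proof.
by move=> bc pab; rewrite -cats1; apply: itv_partition_cat pab (itv_partition1 bc).
Qed.

Lemma itv_partition_ex a b : a <= b -> exists p, itv_partition a b p.
Proof.
rewrite le_eqVlt => /predU1P[->|ab]; first by exists [::]; split => /=.
by exists [:: b]; exact: itv_partition1.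
Qed.

(* Unlike partition sums, such a control function v is easy to glue when two
   curves are concatenated. *)
Definition length_control a b g v := forall s t, a <= s -> s <= t -> t <= b ->
  mdist (g s) (g t) <= v t - v s.

Lemma length_control_curve_length a b g v : length_control a b g v ->
  (curve_length a b g <= (v b - v a)%:E)%E.
Proof.
move=> vP; apply: ge_ereal_sup => _ [p pab <-]; rewrite lee_fin.
elim: p a vP pab => [|c p IH] a vP pab.
  by rewrite metric_variation_nil (itv_partition_nil pab) subrr.
have cb := itv_partition_le (itv_partition_cons pab).
have ac : a <= c by case: pab => /= /andP[/ltW].
rewrite metric_variation_cons.
have : mdist (g a) (g c) <= v c - v a by apply: vP.
have : metric_variation c b g p <= v b - v c.
  apply: IH (itv_partition_cons pab) => s t cs st tb.
  by apply: vP => //; exact: le_trans cs.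
lra.
Qed.

Lemma curve_length_ge a b g p : itv_partition a b p ->
  ((metric_variation a b g p)%:E <= curve_length a b g)%E.
Proof. by move=> pab; apply: ereal_sup_ubound; exists p. Qed.

(** Appending [c] to a partition of [[a, b]] adds exactly this distance. This inequality makes arc
    length a length control. *)
Lemma curve_length_addr_le a b c g : a <= b -> b <= c ->
  (curve_length a b g + (mdist (g b) (g c))%:E <= curve_length a c g)%E.
Proof.
(* Partitions increase strictly, so [c] can be appended only if [b < c]. *)
move=> ab; rewrite le_eqVlt => /predU1P[<-|bc]; first by rewrite mdistxx adde0.
rewrite -leeBrDr//; apply: ge_ereal_sup => _ [p pab <-].
rewrite leeBrDr// -EFinD -metric_variation_rcons//.
by apply: curve_length_ge; exact: itv_partition_rcons pab.
Qed.

(* The arc length function controls a curve of finite length. *)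
Lemma curve_length_length_control a b g (M : R) : a <= b ->
  (curve_length a b g <= M%:E)%E ->
  exists2 v, length_control a b g v & v b - v a <= M.
Proof.
move=> ab gM.
have ge0 t : a <= t -> (0 <= curve_length a t g)%E.
  move=> /itv_partition_ex[p pat]; apply: le_trans (curve_length_ge g pat).
  by rewrite lee_fin sumr_ge0// => i _; exact: mdist_ge0.
have leM t : a <= t -> t <= b -> (curve_length a t g <= M%:E)%E.
  move=> at_ tb; apply: le_trans gM; apply: le_trans (curve_length_addr_le g at_ tb).
  by rewrite leeDl// lee_fin mdist_ge0.
have fin t : a <= t -> t <= b -> curve_length a t g \is a fin_num.
  move=> at_ tb; rewrite ge0_fin_numE ?ge0//.
  by apply: le_lt_trans (leM _ at_ tb) _; rewrite ltry.
exists (fun t => fine (curve_length a t g)).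
  move=> s t as_ st tb; rewrite lerBrDl -lee_fin EFinD !fineK ?fin//.
  - exact: curve_length_addr_le.
  - exact: le_trans as_ st.
  - exact: le_trans st tb.
have aa : (0 <= fine (curve_length a a g)) by rewrite fine_ge0// ge0.
have : fine (curve_length a b g) <= M by rewrite -lee_fin fineK ?fin.
lra.
Qed.

(** The control [v] bounds the length on all subintervals at once, as [locally_rectifiable]
    demands. *)
Definition rectifiably_joined G x y := exists a b g v,
  [/\ curve a b g, length_control a b g v, g @` `[a, b] `<=` G, g a = x & g b = y].

Lemma rectifiably_joined_trans G x y z :
  rectifiably_joined G x y -> rectifiably_joined G y z -> rectifiably_joined G x z.
Proof.
move=> [a [b [g [v [[ab /within_continuousP cg] vP gG ga gb]]]]].
move=> [c [d [h [w [[cd /within_continuousP ch] wP hG hc hd]]]]].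
(* Run [g], then [h] with its time shifted by [b - c]. The constants in [u] make both of its
   formulas equal [v b] at [b]. *)
pose k t := if t <= b then g t else h (t - b + c).
pose u t := if t <= b then v t else v b + w (t - b + c) - w c.
pose e := b + (d - c).
have kr t : b <= t -> k t = h (t - b + c).
  rewrite /k le_eqVlt => /predU1P[<-|]; last by rewrite ltNge => /negbTE ->.
  by rewrite lexx subrr add0r gb hc.
have ur t : b <= t -> u t = v b + w (t - b + c) - w c.
  rewrite /u le_eqVlt => /predU1P[<-|]; last by rewrite ltNge => /negbTE ->.
  by rewrite lexx subrr add0r addrK.
have uP : length_control a e k u.
  have uL s t : a <= s -> s <= t -> t <= b -> mdist (k s) (k t) <= u t - u s.
    by move=> as_ st tb; rewrite /k /u tb (le_trans st tb); exact: vP.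
  have uR s t : b <= s -> s <= t -> t <= e -> mdist (k s) (k t) <= u t - u s.
    move=> bs st te; rewrite !kr ?ur ?(le_trans bs)//.
    have : mdist (h (s - b + c)) (h (t - b + c)) <= w (t - b + c) - w (s - b + c).
      by apply: wP; move: te; rewrite /e; lra.
    lra.
  move=> s t as_ st te.
  (* If [b] separates [s] and [t], the bounds on the two sides telescope through [k b]. *)
  have [tb|/ltW bt] := leP t b; first exact: uL.
  have [sb|/ltW bs] := leP s b; last exact: uR.
  have := metric_triangle (k s) (k b) (k t).
  have := uL _ _ as_ sb (lexx b).
  have := uR _ _ (lexx b) bt te.
  lra.
exists a, e, k, u; split => //.
- split; first by rewrite /e; lra.
  have -> : `[a, e]%classic = `[a, b] `|` `[b, e].
    apply/seteqP; split=> t /=; rewrite !in_itv/= /e; last first.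
      by case=> /andP[? ?]; lra.
    by move=> /andP[at_ te]; have [tb|tb] := leP t b; [left|right]; lra.
  apply: withinU_continuous; [exact: itv_closed|exact: itv_closed| |].
    apply/within_continuousP => t abt r r0; have [dl dl0 P] := cg t abt r r0.
    exists dl => // s abs ts; move: (P s abs ts).
    by move: abt abs; rewrite /= !in_itv /k/= => /andP[_ ->] /andP[_ ->].
  apply/within_continuousP => t; rewrite /= in_itv /e/= => tP r r0.
  have [|dl dl0 P] := ch (t - b + c) _ r r0; first by rewrite /= in_itv/=; lra.
  exists dl => // s; rewrite /= in_itv/= => sP ts.
  rewrite !kr; [|lra|lra]; apply: P; first by rewrite /= in_itv/=; lra.
  by rewrite (_ : _ - _ = t - s)//; lra.
- move=> _ [t /= + <-]; rewrite in_itv/= /e => tP.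
  have [tb|/ltW bt] := leP t b.
    by rewrite /k tb; apply: gG; exists t => //; rewrite /= in_itv/=; lra.
  by rewrite kr//; apply: hG; exists (t - b + c) => //; rewrite /= in_itv/=; lra.
- by rewrite /k ab.
- by rewrite kr /e; [rewrite -hd; congr h; lra|lra].
Qed.

Lemma rectifiably_joined_refl G x : G x -> rectifiably_joined G x x.
Proof.
move=> Gx; exists 0, 0, (cst x), (cst 0); split => //.
- by split => //; exact: cst_continuous.
- by move=> *; rewrite mdistxx subrr.
- by move=> _ [? _ <-].
Qed.

(** A curve of length comparable to the distance of its endpoints cannot leave a ball around [x]
    inside [G] when these are close to [x]. Both directions are stated so that no curve has to be
    reversed. *)
Lemma quasiconvex_locally_joined G x : quasiconvex X -> open G -> G x ->
  \forall y \near x, rectifiably_joined G x y /\ rectifiably_joined G y x.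
Proof.
move=> [C C1 qX] oG Gx.
have /nbhs_mdistP[e e0 eG] := open_nbhs_nbhs (conj oG Gx).
have C0 : 0 < C by lra.
(* The first condition holds both for curves starting at [x] and for curves ending there, as
   [1 <= C]. Every point of the curve is then within [C * mdist y z *+ 2] of [x], whence the radius
   [e / (C *+ 2)]. *)
have joined y z : mdist x y <= C * mdist y z -> C * mdist y z *+ 2 < e ->
    rectifiably_joined G y z.
  move=> xy yz; have [a [b [g [cg ga gb gl]]]] := qX y z.
  have [v vP vM] := curve_length_length_control cg.1 gl.
  exists a, b, g, v; split => // _ [t /= + <-].
  rewrite in_itv/= => /andP[at_ tb]; apply: eG.
  have := metric_triangle x y (g t); rewrite -{2}ga.
  have := vP _ _ (lexx a) at_ tb.
  have := vP _ _ at_ tb (lexx b).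
  have := mdist_ge0 (g t) (g b).
  move: yz; rewrite mulr2n; lra.
apply/nbhs_mdistP; exists (e / (C *+ 2)).
  by rewrite divr_gt0// pmulrn_lgt0.
move=> y; rewrite ltr_pdivlMr ?pmulrn_lgt0// mulrC mulrnAl => xy.
split; apply: joined; rewrite ?mdistxx ?(metric_sym y x)//.
- by rewrite mulr_ge0 ?mdist_ge0// ltW.
- by rewrite ler_peMl// mdist_ge0.
Qed.

(** Reachability from [x] splits [G] into two open sets, and the connected [K] stays in the one
    containing [x]. Thus a continuum without rectifiable curves still yields one in each open set
    around it. *)
Lemma connected_rectifiably_joined G K x y : quasiconvex X -> open G ->
  connected K -> K `<=` G -> K x -> K y -> rectifiably_joined G x y.
Proof.
move=> qX oG cK KG Kx Ky.
pose B := [set z | G z /\ rectifiably_joined G x z].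
pose B' := [set z | G z /\ ~ rectifiably_joined G x z].
have oB : open B.
  rewrite openE => z [Gz xz]; rewrite /interior.
  have nz := quasiconvex_locally_joined qX oG Gz.
  apply: filterS2 nz (open_nbhs_nbhs (conj oG Gz)) => w [zw _] Gw.
  by split => //; exact: rectifiably_joined_trans zw.
have oB' : open B'.
  rewrite openE => z [Gz xz]; rewrite /interior.
  have nz := quasiconvex_locally_joined qX oG Gz.
  apply: filterS2 nz (open_nbhs_nbhs (conj oG Gz)) => w [_ wz] Gw.
  by split => // xw; apply: xz; exact: rectifiably_joined_trans wz.
have KB : K `&` B = K `&` ~` B'.
  apply/seteqP; split=> z [Kz]; first by move=> [_ xz]; split => // -[].
  by move=> /not_andP[/(_ (KG z Kz))//|/contrapT xz]; split => //; split => //; exact: KG.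
have Gx := KG x Kx.
have : (K `&` B) y.
  rewrite (cK (K `&` B))//; last first.
  - by exists (~` B') => //; exact: open_closedC.
  - by exists B.
  - by exists x; split => //; split => //; exact: rectifiably_joined_refl.
by case=> _ [].
Qed.

(** * Inner diameter distance *)

Lemma rectifiably_joined_inner_dist G x y (M : R) :
  (forall z w, G z -> G w -> mdist z w <= M) ->
  rectifiably_joined G x y -> (inner_dist G x y <= M%:E)%E.
Proof.
move=> GM [a [b [g [v [cg vP gG ga gb]]]]].
apply: le_trans (diam_le (A := g @` `[a, b]) _) => [|z w /gG Gz /gG Gw]; last exact: GM.
apply: ereal_inf_lbound; exists a, b, g; split => // c d ac cd db.
apply: le_lt_trans (length_control_curve_length (v := v) _) (ltry _).
move=> s t cs st td; apply: vP => //; [exact: le_trans cs|exact: le_trans db].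
Qed.

Lemma inner_dist_subset Omega G x y : G `<=` Omega ->
  (inner_dist Omega x y <= inner_dist G x y)%E.
Proof.
move=> GO; apply: ereal_inf_le_tmp => _ [a [b [g [cg lg gG gab ->]]]].
by exists a, b, g; split => //; exact: subset_trans GO.
Qed.

Lemma mdist_le_inner_dist Omega x y : ((mdist x y)%:E <= inner_dist Omega x y)%E.
Proof.
apply: le_ereal_inf_tmp => _ [a [b [g [[ab _] _ _ [ga gb] ->]]]].
by apply: mdist_le_diam; [exists a|exists b] => //=; rewrite in_itv/= lexx ab.
Qed.

Lemma inner_set_dist_ge0 Omega A B : (0 <= inner_set_dist Omega A B)%E.
Proof.
apply: le_ereal_inf_tmp => _ [[x y] _ <-].
by apply: le_trans (mdist_le_inner_dist _ _ _); rewrite lee_fin mdist_ge0.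
Qed.

(** The choice of [d] puts the continuum from bounded turning into the ball of radius [e / 2] around
    [x]. A rectifiable curve replacing it inside that ball has diameter at most [e]. *)
Lemma bounded_turning_inner_dist Omega : quasiconvex X -> open Omega ->
  bounded_turning Omega -> forall e : R, 0 < e -> exists2 d : R, 0 < d &
    forall x y, Omega x -> Omega y -> mdist x y < d ->
      (inner_dist Omega x y <= e%:E)%E.
Proof.
move=> qX oO [L L1 btO] e e0; have L0 : 0 < L by lra.
exists (e / 2 / L); first by rewrite !divr_gt0.
move=> x y Ox Oy; rewrite ltr_pdivlMr// mulrC => xy.
have [K [[_ _ cK] KO Kx Ky KL]] := btO x y Ox Oy.
pose G := Omega `&` ball x (e / 2).
have GO : G `<=` Omega by move=> z [].
apply: le_trans (inner_dist_subset x y GO) _.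
apply: rectifiably_joined_inner_dist.
  move=> z w [_ +] [_]; rewrite !ballEmdist/=.
  have := metric_triangle z x w; rewrite (metric_sym z x); lra.
apply: (connected_rectifiably_joined qX _ cK _ Kx Ky).
  by apply: openI => //; exact: open_mball.
move=> z Kz; split; first exact: KO.
rewrite ballEmdist/=; apply: (le_lt_trans _ xy).
by rewrite -lee_fin; apply: (le_trans _ KL); exact: (mdist_le_diam Kx Kz).
Qed.

(** * Total boundedness and limits of ultrafilters *)

Lemma doubling_finite_cover (e r : R) x : doubling X -> 0 < e -> 0 < r ->
  exists2 S : set X, finite_set S & ball x r `<=` \bigcup_(y in S) ball y e.
Proof.
move=> [N dX] e0 r0.
have cover k : exists2 S : set X, finite_set S &
    ball x r `<=` \bigcup_(y in S) ball y (r / 2 ^+ k).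
  elim: k => [|k [S finS xS]].
    by exists [set x] => // z xz; exists x => //; rewrite expr0 divr1.
  have rk0 : 0 < r / 2 ^+ k by rewrite divr_gt0// exprn_gt0.
  have /choice[s sP] y : exists s : seq X,
      ball y (r / 2 ^+ k) `<=` \bigcup_(z in [set` s]) ball z (r / 2 ^+ k.+1).
    have [s _ ys] := dX y _ rk0; exists s.
    by rewrite exprSr invfM mulrA.
  exists (\bigcup_(y in S) [set` s y]).
    by apply: bigcup_finite => // y _; exact: finite_seq.
  move=> z /xS[y Sy /sP[w sw wz]]; exists w => //.
  by exists y.
have [k kP] : exists k, r / 2 ^+ k < e.
  exists (Num.bound (r / e)).
  by rewrite ltr_pdivrMr ?exprn_gt0// mulrC -ltr_pdivrMr// upper_nthrootP.
have [S finS xS] := cover k; exists S => // z /xS[y Sy yz].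
by exists y => //; exact: le_ball (ltW kP) _ yz.
Qed.

Lemma bounded_finite_cover (e : R) A : doubling X -> bounded_subset A -> 0 < e ->
  exists2 S : set X, finite_set S & A `<=` \bigcup_(y in S) ball y e.
Proof.
move=> dX bA e0.
have [->|/set0P[x Ax]] := eqVneq A set0; first by exists set0.
have [M [M0 AM]] : exists M : R, 0 < M /\ A `<=` ball x M.
  (* Balls are open and [diam A] may be 0, hence the added 1. *)
  exists (fine (diam A) + 1).
  have dA : diam A \is a fin_num.
    rewrite ge0_fin_numE//; apply: le_trans (mdist_le_diam Ax Ax).
    by rewrite lee_fin mdist_ge0.
  have xA y : A y -> mdist x y <= fine (diam A).
    by move=> Ay; rewrite -lee_fin fineK// mdist_le_diam.
  split; first by have := xA x Ax; have := mdist_ge0 x x; lra.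
  by move=> y /xA; rewrite ballEmdist/=; lra.
have [S finS xS] := doubling_finite_cover x dX e0 M0.
by exists S => //; exact: subset_trans xS.
Qed.

(** The image ultrafilter contains a ball of each finite cover of [A], so it is Cauchy. *)
Lemma bounded_ultrafilter_cvg (T : Type) A (u : T -> X) (F : set_system T) :
  complete_space X -> doubling X -> bounded_subset A -> UltraFilter F ->
  F (u @^-1` A) -> exists x : X, u @ F --> x.
Proof.
move=> cX dX bA FU FA; apply: cX; apply/cauchyP => e e0.
have [S finS AS] := bounded_finite_cover dX bA e0.
have [|y _ Fy] :=
    ultrafilter_finite_bigcup (A := fun y => u @^-1` ball y e) FU finS.
  by apply: filterS FA => t /AS.
by exists y.
Qed.

End metric_space.

(** The trace on [D] of a small neighbourhood of [y] is a finite union of components, so the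
    ultrafilter selects one of them. *)
Lemma finitely_connected_ultrafilter (R : realType) (Y : metricType R)
    (D : set Y) (y : Y) (r : R) (T : Type) (u : T -> Y) (F : set_system T) :
  finitely_connected_at_boundary D -> boundary D y -> 0 < r ->
  UltraFilter F -> u @ F --> y -> F (u @^-1` D) ->
  exists V : set Y, [/\ connected V, V `<=` D, V `<=` ball y r & F (u @^-1` V)].
Proof.
move=> fcD Dy r0 FU Fy FD; have [U [oU _ Uy Ur finU]] := fcD y r Dy r0.
have FUD : F (u @^-1` (U `&` D)).
  by apply: filterI => //; apply: Fy; exact: open_nbhs_nbhs.
have [|V [z _ <-] FV] :=
    ultrafilter_finite_bigcup (A := fun Z => u @^-1` Z) FU finU.
  apply: filterS FUD => t UDt; exists (connected_component (U `&` D) (u t)).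
    by exists (u t).
  exact: connected_component_refl.
exists (connected_component (U `&` D) z); split => //.
- exact: component_connected.
- by move=> w /connected_component_sub[].
- by move=> w /connected_component_sub[/Ur].
Qed.

Lemma open_boundaryN (T : topologicalType) (A : set T) x :
  open A -> boundary A x -> ~ A x.
Proof. by move=> /interior_id iA [_ +]; rewrite iA. Qed.

(** * Boundary limits of homeomorphisms in the class *)

Section class_F.
Context {R : realType} {X Y : metricType R}.
Implicit Types (Omega : set X) (D : set Y) (f : X -> Y).

(** If [y] were in [D], continuity of the inverse [h] at [y] would give [x = h y], a point of the
    open set [Omega]. *)
Lemma homeomorphism_boundary_limit Omega D f x y (F : set_system X)
     {PF : ProperFilter F} :
  homeomorphism Omega D f -> open Omega -> open D -> boundary Omega x ->
  F Omega -> F --> x -> f @ F --> y -> boundary D y.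
Proof.
move=> [[fOD _ fsurj] _ [h fh ch]] oO oD Ox FO Fx Fy.
have FfD : \forall z \near F, D (f z) by apply: filterS FO => z /fOD.
split.
  move=> B /Fy /= FB; have [z [Dz Bz]] := filter_ex (filterI FfD FB).
  by exists (f z).
have /interior_id -> := oD; move=> Dy.
have [w Ow wy] := fsurj _ Dy.
have fK z : Omega z -> h (f z) = z by move=> Oz; apply: fh; exact: mem_set.
suff xh : x = h y by apply: (open_boundaryN oO Ox); rewrite xh -wy fK.
apply: (cvg_unique (@metric_hausdorff _ X) Fx) => B hB.
move/subspace_continuousP: ch => /(_ y Dy) hy.
have FB := Fy _ (hy _ hB).
by apply: filterS3 FfD FO FB => z Dz Oz /(_ Dz) Bz; rewrite -(fK z Oz).
Qed.

(** The two ultrafilters stand for two sequences tending to [x] along an end-cut; the argument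
    compares the components of [D] that they select. *)
Lemma classF_ultrafilter_limit_unique Omega D f (x : X) (y1 y2 : Y)
    (F1 F2 : set_system X) :
  quasiconvex X -> open Omega -> bounded_turning Omega ->
  open D -> finitely_connected_at_boundary D -> classF Omega D f ->
  boundary Omega x ->
  UltraFilter F1 -> F1 Omega -> F1 --> x -> f @ F1 --> y1 ->
  UltraFilter F2 -> F2 Omega -> F2 --> x -> f @ F2 --> y2 -> y1 = y2.
Proof.
move=> qX oO btO oD fcD [hf fP] Ox U1 O1 x1 fy1 U2 O2 x2 fy2.
apply: contrapT => /eqP; rewrite -mdist_gt0 => y12.
(* With a third of the distance, points of the balls of radius [r] around [y1] and [y2] are at least
   [r] apart. *)
set r := mdist y1 y2 / 3; have r0 : 0 < r by rewrite divr_gt0.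
have Dy1 : boundary D y1 by exact: homeomorphism_boundary_limit hf _ _ Ox O1 x1 fy1.
have Dy2 : boundary D y2 by exact: homeomorphism_boundary_limit hf _ _ Ox O2 x2 fy2.
have [[fOD _ fsurj] _ [h fh ch]] := hf.
have fO F : Filter F -> F Omega -> F (f @^-1` D).
  by move=> FF; apply: filterS => z /fOD.
have [V1 [cV1 V1D V1y F1V]] :=
  finitely_connected_ultrafilter fcD Dy1 r0 U1 fy1 (fO _ _ O1).
have [V2 [cV2 V2D V2y F2V]] :=
  finitely_connected_ultrafilter fcD Dy2 r0 U2 fy2 (fO _ _ O2).
have V12 v w : V1 v -> V2 w -> r <= mdist v w.
  move=> /V1y + /V2y; rewrite !ballEmdist/= => y1v y2w.
  have := metric_triangle y1 v y2; have := metric_triangle v w y2.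
  by rewrite (metric_sym w y2); move: y1v y2w; rewrite /r; lra.
have fK z : Omega z -> h (f z) = z by move=> Oz; apply: fh; exact: mem_set.
have fhD v : D v -> Omega (h v) /\ f (h v) = v.
  by move=> /fsurj[w Ow <-]; rewrite fK.
(* The preimage of [V] is written as its image under [h], so that its connectedness follows from the
   continuity of [h]. *)
have hV V : V `<=` D -> f @` (h @` V) = V.
  move=> VD; apply/seteqP; split=> [_ [_ [v Vv <-] <-]|v Vv].
    by rewrite (fhD v (VD v Vv)).2.
  by exists (h v); [exists v|rewrite (fhD v (VD v Vv)).2].
have preV V z : Omega z -> V (f z) -> (h @` V) z.
  by move=> Oz Vz; exists (f z) => //; exact: fK.
have chV V : V `<=` D -> connected V -> connected (h @` V).
  move=> VD cV; apply: connected_continuous_connected => //.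
  exact: continuous_subspaceW ch.
(* [classF] speaks of proper subsets of [Omega]: [z2] lies outside the preimage of [V1], and [z1]
   outside that of [V2]. *)
have [z1 [Oz1 V1z1]] := filter_ex (filterI O1 F1V).
have [z2 [Oz2 V2z2]] := filter_ex (filterI O2 F2V).
have disj v : V1 v -> V2 v -> False.
  by move=> /V12 /[apply]; rewrite mdistxx; lra.
have pV V z : V `<=` D -> Omega z -> ~ V (f z) -> h @` V `<` Omega.
  move=> VD Oz Vz; split; last first.
    by move=> /(_ z Oz)[v Vv hv]; apply: Vz; rewrite -hv (fhD v (VD v Vv)).2.
  by move=> _ [v Vv <-]; have [] := fhD v (VD v Vv).
have E0 : inner_set_dist Omega (h @` V1) (h @` V2) = 0%E.
  apply/eqP; rewrite eq_le inner_set_dist_ge0 andbT.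
  apply/lee_addgt0Pr => e e0; rewrite add0e.
  have [d d0 dP] := bounded_turning_inner_dist qX oO btO e0.
  (* Each preimage has a point within [d / 2] of [x], which makes these two points less than [d]
     apart. *)
  have xd : nbhs x [set z | mdist x z < d / 2].
    by apply/nbhs_mdistP; exists (d / 2); rewrite ?divr_gt0.
  have [a1 [[Oa1 Va1] xa1]] := filter_ex (filterI (filterI O1 F1V) (x1 _ xd)).
  have [a2 [[Oa2 Va2] xa2]] := filter_ex (filterI (filterI O2 F2V) (x2 _ xd)).
  apply: (@le_trans _ _ (inner_dist Omega a1 a2)); last first.
    apply: dP => //; have := metric_triangle a1 x a2.
    by rewrite (metric_sym a1 x); move: xa1 xa2 => /=; lra.
  by apply: ereal_inf_lbound; exists (a1, a2) => //; split; exact: preV.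
have := (fP _ _ (chV _ V1D cV1) (chV _ V2D cV2)
  (pV _ z2 V1D Oz2 (fun v1 => disj _ v1 V2z2))
  (pV _ z1 V2D Oz1 (disj _ V1z1))).1 E0.
rewrite !hV// => D0.
have : (r%:E <= inner_set_dist D V1 V2)%E.
  apply: le_ereal_inf_tmp => _ [[v w] /= [Vv Vw] <-].
  by apply: le_trans (mdist_le_inner_dist _ _ _); rewrite lee_fin V12.
by rewrite D0 lee_fin leNgt r0.
Qed.

End class_F.

(** * Cluster sets along end-cuts *)

Section end_cuts.
Context {R : realType} {X Y : metricType R}.
Implicit Types (Omega : set X) (D : set Y) (f : X -> Y) (g : R -> X) (x : X).

Lemma end_cut_in Omega g x (t : R) : end_cut Omega x g -> 0 < t < 1 -> Omega (g t).
Proof.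
move=> [_ _ gO] /andP[/ltW t0 t1]; apply: gO; exists t => //=.
by rewrite in_itv/= t0.
Qed.

Lemma end_cut_cvg Omega g x : end_cut Omega x g -> g @ (1 : R)^'- --> x.
Proof.
move=> [[_ /within_continuousP cg] g1 _].
apply/metricType_numDomainType.cvgrPdist_lt => e e0.
have [|d d0 dP] := cg 1 _ e e0; first by rewrite /= in_itv/= ler01 lexx.
near=> t; rewrite -g1; apply: dP.
  by rewrite /= in_itv/=; apply/andP; split; apply: ltW; near: t;
    [exact: nbhs_left_gt|exact: nbhs_left_lt].
rewrite gtr0_norm ?subr_gt0; last by near: t; exact: nbhs_left_lt.
by rewrite ltrBlDr -ltrBlDl; near: t; apply: nbhs_left_gt; lra.
Unshelve. all: by end_near. Qed.

(** An ultrafilter refining the image of [\oo] under the sequence inherits both limits. *)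
Lemma cluster_set_ultrafilter Omega f g x y :
  end_cut Omega x g -> cluster_set g f x y ->
  exists F : set_system X, [/\ UltraFilter F, F Omega, F --> x & f @ F --> y].
Proof.
move=> gx [u [t [t01 _ ut ux]] fuy].
have [F [FU uF]] := ultraFilterLemma (fmap_proper_filter u eventually_filter).
exists F; split => //.
- by apply: uF; exists 0%N => // n _; rewrite ut; exact: end_cut_in gx _.
- by move=> B /ux; exact: uF.
- by move=> B /fuy; exact: uF.
Qed.

Lemma end_cut_cluster_set_nonempty Omega D f g x : end_cut Omega x g ->
  complete_space Y -> doubling Y -> bounded_subset D -> set_fun Omega D f ->
  cluster_set g f x !=set0.
Proof.
move=> gx cY dY bD fOD.
have [F [FU F1]] := ultraFilterLemma (at_left_proper_filter (1 : R)).
have F01 a : a < 1 -> F [set t | a < t < 1].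
  move=> a1; apply: F1; near=> t; apply/andP; split; near: t.
    exact: nbhs_left_gt.
  exact: nbhs_left_lt.
have [|y Fy] := bounded_ultrafilter_cvg (u := f \o g) cY dY bD FU.
  by apply: filterS (F01 0 ltr01) => t t01; apply: fOD; exact: end_cut_in gx _.
exists y.
(* Back from the ultrafilter to a sequence: for each [n] the three conditions define sets of [F],
   which therefore have a common point. *)
have /choice[t tP] n : exists t,
    [/\ 0 < t < 1, 1 - n.+1%:R^-1 < t & mdist y (f (g t)) < n.+1%:R^-1].
  have n0 : 0 < n.+1%:R^-1 :> R by rewrite invr_gt0.
  have n1 : 1 - n.+1%:R^-1 < 1 :> R by rewrite ltrBlDr ltrDl.
  have Fn : F ((f \o g) @^-1` [set z | mdist y z < n.+1%:R^-1]).
    by apply: Fy; apply/nbhs_mdistP; exists n.+1%:R^-1.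
  have [t [[t01 /andP[nt _]] ty]] :=
    filter_ex (filterI (filterI (F01 0 ltr01) (F01 _ n1)) Fn).
  by exists t.
have t1 : t @ \oo --> (1 : R).
  apply/cvgrPdist_lt => e e0; near=> n; have [/andP[_ tn1] tn _] := tP n.
  rewrite gtr0_norm ?subr_gt0//; apply: (@lt_trans _ _ n.+1%:R^-1).
    by rewrite ltrBlDr -ltrBlDl.
  by near: n; exact: near_infty_natSinv_lt (PosNum e0).
exists (g \o t).
  exists t; split => //; first by move=> n; have [] := tP n.
  (* The limit of [g] is taken from the left of 1, so [t n < 1] is needed besides the convergence of
     [t]. *)
  apply: cvg_comp (end_cut_cvg gx) => B /t1 tB.
  have {tB} : \forall n \near \oo, t n < 1 -> B (t n) by [].
  by apply: filterS => n; apply; have [/andP[]] := tP n.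
apply/metricType_numDomainType.cvgrPdist_lt => e e0.
near=> n; have [_ _ /lt_trans] := tP n; apply.
by near: n; exact: near_infty_natSinv_lt (PosNum e0).
Unshelve. all: by end_near. Qed.

End end_cuts.

Theorem theorem6 (R : realType) (X Y : metricType R)
    (Omega : set X) (D : set Y) (f : X -> Y) :
  complete_space X -> doubling X -> quasiconvex X ->
  complete_space Y -> doubling Y -> quasiconvex Y ->
  domain Omega -> bounded_subset Omega -> Omega `<` setT ->
  bounded_turning Omega ->
  domain D -> bounded_subset D -> D `<` setT ->
  finitely_connected_at_boundary D ->
  classF Omega D f ->
  arcwise_limits_along_all_end_cuts Omega f.
Proof.
move=> _ _ qX cY dY _ [_ oO _] _ _ btO [_ oD _] bD _ fcD fF x g Ox gx.
have [[fOD _ _] _ _] := fF.1.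
have [y gy] := end_cut_cluster_set_nonempty gx cY dY bD fOD.
exists y; apply/seteqP; split=> [z gz|_ ->//].
have [F1 [U1 O1 x1 y1]] := cluster_set_ultrafilter gx gz.
have [F2 [U2 O2 x2 y2]] := cluster_set_ultrafilter gx gy.
exact: classF_ultrafilter_limit_unique qX oO btO oD fcD fF Ox
  U1 O1 x1 y1 U2 O2 x2 y2.
Qed.
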